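(* Let $A\in\mathbb{C}^{m\times m}$ and $B\in\mathbb{C}^{n\times n}$ be normal matrices with $m\ge n$, and let $E,F\subseteq\mathbb{C}$ be sets such that the spectrum of $A$ is a subset of $E$ and the spectrum of $B$ is a subset of $F$. Suppose that the matrix $X\in\mathbb{C}^{m\times n}$, of rank $r\ge 1$, satisfies $$AX-XB=MN^{*},\qquad M\in\mathbb{C}^{m\times\nu},\quad N\in\mathbb{C}^{n\times\nu},$$ where $1\le\nu\le n$ is an integer. Then, for all integers $k$ with $0\le k\le\frac{n-1}{\nu}$, $$\frac{\sigma_1(X)}{\sigma_{1+\nu k}(X)}\ge \bigl(Z_k(E,F)\bigr)^{-1}.$$ In particular, $$\kappa_2(X)\ge\bigl(Z_\ell(E,F)\bigr)^{-1},\qquad \ell=\Bigl\lfloor\frac{r-1}{\nu}\Bigr\rfloor.$$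
   Context: $\sigma_1(X)\ge\sigma_2(X)\ge\dots\ge\sigma_n(X)\ge 0$ are the singular values of $X$, and $\kappa_2(X)=\|X\|_2\|X^{+}\|_2=\sigma_1(X)/\sigma_r(X)$, where $X^+$ is the Moore--Penrose pseudoinverse and $r=\operatorname{rank}(X)$. The Zolotarev number is $$Z_k(E,F):=\inf_{\rho\in\mathcal{R}_{k,k}}\frac{\sup_{z\in E}|\rho(z)|}{\inf_{z\in F}|\rho(z)|},$$ where $\mathcal{R}_{k,k}$ is the set of irreducible rational functions $p(x)/q(x)$ with $p$ and $q$ polynomials of degree at most $k$. Conventions: $|\rho(z)|=\infty$ at a pole of $\rho$; functions for which the quotient has the indeterminate form $0/0$ or $\infty/\infty$ are disregarded in the infimum; the quotient $\sigma_1(X)/\sigma_{1+\nu k}(X)$ is $+\infty$ when $\sigma_{1+\nu k}(X)=0$, and $Z_k(E,F)^{-1}=+\infty$ when $Z_k(E,F)=0$. *)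

(* Defs.v *)
From HB Require Import structures.
From mathcomp Require Import all_boot all_order all_algebra.
From mathcomp Require Import complex.
From mathcomp Require Import boolp classical_sets reals ereal.

Set Implicit Arguments.
Unset Strict Implicit.
Unset Printing Implicit Defensive.

Import Order.TTheory GRing.Theory Num.Theory.

Local Open Scope ring_scope.
Local Open Scope complex_scope.
Local Open Scope sesquilinear_scope.
Local Open Scope classical_set_scope.

Section Defs.
Variable R : realType.
Local Notation C := R[i].

Definition l2norm n (v : 'cV[C]_n) : R := Num.sqrt (\sum_i Normc.normc (v i 0) ^+ 2).

(* The set is nonempty and bounded above, so [sup] does not take its default
   value. *)
Definition spectral_norm m n (X : 'M[C]_(m, n)) : R :=
  sup [set l2norm (X *m v) | v in [set v | l2norm v <= 1]].

(* The square roots, in nonincreasing order, of the n eigenvalues of X^* X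
   counted with multiplicity, read off a unitary diagonalization of X^* X
   (see [char_poly_singular_values]). *)
Definition singular_values m n (X : 'M[C]_(m, n)) : seq R :=
  sort (fun x y => y <= x)
    [seq Num.sqrt (complex.Re (spectral_diag (X^t* *m X) 0 i)) | i : 'I_n].

(* Numbered from 1: meaningful for 1 <= j <= n, and [sigma X j = 0] for n < j. *)
Definition sigma m n (X : 'M[C]_(m, n)) (j : nat) : R :=
  nth 0 (singular_values X) j.-1.

Definition moore_penrose m n (X : 'M[C]_(m, n)) (Y : 'M[C]_(n, m)) : Prop :=
  [/\ X *m Y *m X = X,
      Y *m X *m Y = Y,
      (X *m Y)^t* = X *m Y &
      (Y *m X)^t* = Y *m X].

(* By [moore_penrose_pinv] and [moore_penrose_uniq] the default value 0 is
   never used and the choice is forced. *)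
Definition pinv m n (X : 'M[C]_(m, n)) : 'M[C]_(n, m) :=
  xget 0 [set Y | moore_penrose X Y].

Definition cond2 m n (X : 'M[C]_(m, n)) : R :=
  spectral_norm X * spectral_norm (pinv X).

(* The pair (p, q) stands for p / q in lowest terms. The function 0 is
   represented by the pairs (0, c) with c a nonzero constant. *)
Definition ratfun (k : nat) : set ({poly C} * {poly C}) :=
  [set r | [/\ coprimep r.1 r.2, r.2 != 0,
               (size r.1 <= k.+1)%N & (size r.2 <= k.+1)%N]].

Definition ratabs (r : {poly C} * {poly C}) (z : C) : \bar R :=
  if root r.2 z then +oo%E else (Normc.normc (r.1.[z] / r.2.[z]))%:E.

Definition ratsup (E : set C) (r : {poly C} * {poly C}) : \bar R :=
  ereal_sup [set ratabs r z | z in E].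

Definition ratinf (F : set C) (r : {poly C} * {poly C}) : \bar R :=
  ereal_inf [set ratabs r z | z in F].

Definition indeterminate (a b : \bar R) : Prop :=
  (a = 0%E /\ b = 0%E) \/ (a = +oo%E /\ b = +oo%E).

(* In [\bar R], [x / y] is [x * y^-1] with [0^-1 = +oo] and [+oo^-1 = 0], so a
   quotient that is not indeterminate has its usual value in [0, +oo]. The sets
   E and F are meant to be nonempty: for empty sets the extended supremum and
   infimum are -oo and +oo. *)
Definition zolotarev (k : nat) (E F : set C) : \bar R :=
  ereal_inf [set (ratsup E r / ratinf F r)%E | r in
    [set r | ratfun k r /\ ~ indeterminate (ratsup E r) (ratinf F r)]].

Lemma mul_adj a b c (P : 'M[C]_(a, b)) (Q : 'M[C]_(b, c)) :
  (P *m Q)^t* = Q^t* *m P^t*.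
Proof. by rewrite trmx_mul map_mxM. Qed.

Lemma moore_penrose_uniq m n (X : 'M[C]_(m, n)) (Y Z : 'M[C]_(n, m)) :
  moore_penrose X Y -> moore_penrose X Z -> Y = Z.
Proof.
move=> [y1 y2 y3 y4] [z1 z2 z3 z4].
have eXY : X *m Y = X *m Z.
  have -> : X *m Y = (X *m Z *m (X *m Y))^t* by rewrite mulmxA z1 y3.
  by rewrite mul_adj y3 z3 mulmxA y1.
have eYX : Y *m X = Z *m X.
  have -> : Y *m X = (Y *m X *m (Z *m X))^t* by rewrite -mulmxA (mulmxA X) z1 y4.
  by rewrite mul_adj y4 z4 -mulmxA (mulmxA X) y1.
by rewrite -y2 -z2 eYX -mulmxA eXY mulmxA.
Qed.

Lemma gram_unit m n (A : 'M[C]_(m, n)) : row_free A -> A *m A^t* \in unitmx.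
Proof.
move=> fA; rewrite -row_free_unit; apply: inj_row_free => u uAA0.
apply/eqP; rewrite -(mulmx_free_eq0 _ fA); apply/eqP.
have : dotmx (u *m A) (u *m A) = 0.
  by rewrite dotmxE mul_adj mulmxA -(mulmxA u) uAA0 mul0mx mxE.
by apply: contra_eq => uA0; rewrite gt_eqF // dotmx_is_dotmx.
Qed.

Lemma moore_penrose_pinv m n (X : 'M[C]_(m, n)) : moore_penrose X (pinv X).
Proof.
apply: xgetPex.
have [r [K [L [XE fK fL]]]] : exists r (K : 'M[C]_(m, r)) (L : 'M[C]_(r, n)),
    [/\ X = K *m L, row_full K & row_free L].
  exists (\rank X), (col_base X), (row_base X).
  by rewrite mulmx_base col_base_full row_base_free.
have uL : L *m L^t* \in unitmx by rewrite gram_unit.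
have uK : K^t* *m K \in unitmx.
  by rewrite -{2}[K]trmxCK gram_unit // /row_free mxrank_map mxrank_tr.
have adjL : (invmx (L *m L^t*))^t* = invmx (L *m L^t*).
  by rewrite trmx_inv map_invmx mul_adj trmxCK.
have adjK : (invmx (K^t* *m K))^t* = invmx (K^t* *m K).
  by rewrite trmx_inv map_invmx mul_adj trmxCK.
have := mulmxV uL; have := mulVmx uK; rewrite {}XE.
move: (invmx (L *m L^t*)) (invmx (K^t* *m K)) adjL adjK => U V adjU adjV.
have := trmxCK K; have := trmxCK L.
move: (L^t*) (K^t*) => L' K' adjL adjK VK LU; exists (L' *m U *m (V *m K')).
have KLY : K *m L *m (L' *m U *m (V *m K')) = K *m (V *m K').
  by rewrite -!mulmxA; congr (_ *m _); rewrite !mulmxA LU mul1mx.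
have YKL : L' *m U *m (V *m K') *m (K *m L) = L' *m U *m L.
  by rewrite -!mulmxA; do 2!congr (_ *m _); rewrite !mulmxA -(mulmxA V) VK mul1mx.
split.
- by rewrite KLY -!mulmxA; congr (_ *m _); rewrite !mulmxA -(mulmxA V) VK mul1mx.
- by rewrite YKL -!mulmxA; do 2!congr (_ *m _); rewrite !mulmxA LU mul1mx.
- by rewrite KLY !mul_adj adjV -adjK trmxCK mulmxA.
- by rewrite YKL !mul_adj adjU -adjL trmxCK mulmxA.
Qed.

Lemma char_poly_singular_values m n (X : 'M[C]_(m, n)) :
  char_poly (X^t* *m X) = \prod_(s <- singular_values X) ('X - ((s ^+ 2)%:C)%:P).
Proof.
set A := X^t* *m X; set P := spectralmx A; set D := spectral_diag A.
have nA : A \is normalmx.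
  by apply/normalmxP; rewrite mul_adj trmxCK.
have AE : A = invmx P *m diag_mx D *m P by apply: orthomx_spectralP.
have uP : P \in unitmx by apply: spectral_unit.
have DE : diag_mx D = (X *m P^t*)^t* *m (X *m P^t*).
  have PE := spectral_unitarymx A.
  rewrite mul_adj trmxCK -mulmxA (mulmxA _ X) -/A AE -(invmx_unitary PE) -/P.
  by rewrite -!mulmxA mulmxV // mulmx1 !mulmxA mulmxV // mul1mx.
have D0 i : 0 <= D 0 i.
  have -> : D 0 i = diag_mx D i i by rewrite mxE eqxx mulr1n.
  rewrite DE mxE sumr_ge0 // => j _; rewrite !mxE.
  by rewrite mulrC mul_conjC_ge0.
rewrite (perm_big [seq Num.sqrt (complex.Re (D 0 i)) | i : 'I_n]) /=; last first.
  by rewrite perm_sort.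
rewrite big_map big_enum /=.
have -> : char_poly A = char_poly (diag_mx D).
  rewrite AE /char_poly /char_poly_mx !map_mxM.
  set Q := map_mx polyC P; set Q' := map_mx polyC (invmx P).
  have Q'Q : Q' *m Q = 1%:M by rewrite -map_mxM mulVmx // map_mx1.
  have XE : 'X%:M = Q' *m 'X%:M *m Q.
    by rewrite mul_mx_scalar -scalemxAl Q'Q scalemx1.
  rewrite [in LHS]XE -mulmxBl -mulmxBr !det_mulmx mulrAC -det_mulmx Q'Q det1.
  by rewrite mul1r.
rewrite char_poly_trig ?diag_mx_is_trig //.
apply: eq_bigr => i _; rewrite mxE eqxx mulr1n.
have := D0 i; case: (D 0 i) => a b /=; rewrite lecE /= => /andP[/eqP -> a0].
by rewrite sqr_sqrtr.
Qed.

End Defs.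

(* Main.v *)
Require Import Defs.
From mathcomp Require Import all_boot all_order all_algebra.
From mathcomp Require Import complex.
From mathcomp Require Import boolp classical_sets reals ereal.
From mathcomp Require Import ring.
From mathcomp Require Import perm.

(* Let rho = p / q be admissible for Z_k(E, F), and put Y := rho(A) X rho(B)^-1.
   In spectral coordinates of A and B, the entries of q(A) (X - Y) p(B) are those
   of X times q(a_i) p(b_j) - p(a_i) q(b_j). This polynomial is divisible by
   a_i - b_j, with a quotient of degree less than k in a_i, and X_ij (a_i - b_j)
   is an entry of a matrix of rank at most nu; so X - Y has rank at most nu k.
   By the Eckart-Young theorem sigma_(1 + nu k)(X) is at most the norm of Y, hence
   at most sigma_1(X) sup_E |rho| / inf_F |rho|. *)

Set Implicit Arguments.
Unset Strict Implicit.
Unset Printing Implicit Defensive.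

Import Order.TTheory GRing.Theory Num.Theory.

Local Open Scope ring_scope.
Local Open Scope complex_scope.
Local Open Scope sesquilinear_scope.
Local Open Scope classical_set_scope.

(** * Rank of a matrix of divided differences *)

Lemma mxrank_sum_leq (F : fieldType) (I : finType) m n (W : I -> 'M[F]_(m, n)) :
  (\rank (\sum_i W i)%R <= \sum_i \rank (W i))%N.
Proof.
elim/big_rec2: _ => [|i r V _ le]; first by rewrite mxrank0.
by rewrite (leq_trans (mxrank_add _ _)) ?leq_add2l.
Qed.

(** Expanding each quotient [g j] in powers of a_i writes the matrix as a sum of k terms, one per
    power s. Each term is the commutator [W] with its rows scaled by a_i^s and its columns by the
    s-th coefficient of [g j], so its rank is at most that of [W]. *)
Lemma rank_divided_difference (F : fieldType) m n k (a : 'rV[F]_m) (b : 'rV[F]_n)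
    (X : 'M[F]_(m, n)) (p q : {poly F}) :
  (size p <= k.+1)%N -> (size q <= k.+1)%N ->
  (\rank (\matrix_(i, j) (X i j * (p.[a 0 i] * q.[b 0 j] - q.[a 0 i] * p.[b 0 j])))%R
     <= k * \rank (diag_mx a *m X - X *m diag_mx b)%R)%N.
Proof.
move=> sp sq; set W := diag_mx a *m X - X *m diag_mx b.
pose h j := q.[b 0 j] *: p - p.[b 0 j] *: q.
have root_h j : root (h j) (b 0 j).
  by rewrite /root !hornerE mulrC subrr.
pose g j := h j %/ ('X - (b 0 j)%:P).
have gE j : h j = g j * ('X - (b 0 j)%:P).
  by apply/esym/divpK; rewrite dvdp_XsubCl.
have size_g j : (size (g j) <= k)%N.
  rewrite /g size_divp ?polyXsubC_eq0 // size_XsubC leq_subLR add1n.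
  rewrite (leq_trans (size_polyD _ _)) // size_polyN geq_max.
  by rewrite !(leq_trans (size_scale_leq _ _)).
have -> : \matrix_(i, j) (X i j * (p.[a 0 i] * q.[b 0 j] - q.[a 0 i] * p.[b 0 j]))
    = \sum_(s < k) diag_mx (\row_i a 0 i ^+ s) *m W *m diag_mx (\row_j (g j)`_s).
  apply/matrixP => i j; rewrite mxE summxE.
  have WE : W i j = a 0 i * X i j - X i j * b 0 j.
    by rewrite /W mul_diag_mx mul_mx_diag !mxE.
  have -> : p.[a 0 i] * q.[b 0 j] - q.[a 0 i] * p.[b 0 j] = (h j).[a 0 i].
    by rewrite /h !hornerE; congr (_ - _); rewrite mulrC.
  rewrite gE hornerM hornerXsubC (horner_coef_wide _ (size_g j)).
  rewrite mulr_suml mulr_sumr; apply: eq_bigr => s _.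
  rewrite mul_mx_diag mxE mul_diag_mx mxE WE !mxE.
  by ring.
apply: (leq_trans (mxrank_sum_leq _)).
rewrite -[X in (X * _)%N]card_ord -sum_nat_const leq_sum // => s _.
by rewrite (leq_trans (mxrankM_maxl _ _)) ?mxrankM_maxr.
Qed.

(** * Squared Euclidean norms of column vectors *)

Section SqNorm.
Variable C : numClosedFieldType.

(** Squared and valued in [C] itself, so that Gram matrices and the order of [C] apply with no
    square root; [sqnorm_l2norm] links it to [l2norm]. *)
Definition sqnorm n (v : 'cV[C]_n) : C := (v^t* *m v) 0 0.

Lemma sqnormE n (v : 'cV[C]_n) : sqnorm v = \sum_i `|v i 0| ^+ 2.
Proof. by rewrite /sqnorm mxE; apply: eq_bigr => i _; rewrite !mxE normCK mulrC. Qed.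

Lemma sqnorm_ge0 n (v : 'cV[C]_n) : 0 <= sqnorm v.
Proof. by rewrite sqnormE sumr_ge0 // => i _; rewrite exprn_ge0. Qed.

Lemma sqnorm_eq0 n (v : 'cV[C]_n) : (sqnorm v == 0) = (v == 0).
Proof.
rewrite sqnormE psumr_eq0 => [|i _]; last by rewrite exprn_ge0 //.
apply/allP/eqP => [v0|-> i _]; last by rewrite mxE normr0 expr0n /= eqxx.
apply/matrixP => i j; rewrite ord1 mxE; apply/eqP.
by have := v0 i (mem_index_enum i); rewrite sqrf_eq0 normr_eq0.
Qed.

Lemma sqnorm_gt0 n (v : 'cV[C]_n) : (0 < sqnorm v) = (v != 0).
Proof. by rewrite lt_def sqnorm_ge0 andbT sqnorm_eq0. Qed.

Lemma sqnormM m n (X : 'M[C]_(m, n)) (v : 'cV[C]_n) :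
  sqnorm (X *m v) = (v^t* *m (X^t* *m X) *m v) 0 0.
Proof. by rewrite /sqnorm trmx_mul map_mxM /= !mulmxA. Qed.

Lemma sqnorm_isometry m n (U : 'M[C]_(m, n)) (v : 'cV[C]_n) :
  U^t* *m U = 1%:M -> sqnorm (U *m v) = sqnorm v.
Proof. by move=> UU; rewrite sqnormM UU mulmx1. Qed.

Lemma sqnorm_diag n (d : 'rV[C]_n) (v : 'cV[C]_n) :
  sqnorm (diag_mx d *m v) = \sum_i `|d 0 i| ^+ 2 * `|v i 0| ^+ 2.
Proof.
by rewrite sqnormE; apply: eq_bigr => i _; rewrite mul_diag_mx mxE normrM exprMn.
Qed.

Lemma sqnorm_diag_le n (d : 'rV[C]_n) (c : C) (v : 'cV[C]_n) :
  (forall i, `|d 0 i| <= c) -> sqnorm (diag_mx d *m v) <= c ^+ 2 * sqnorm v.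
Proof.
move=> dc; rewrite sqnorm_diag sqnormE mulr_sumr ler_sum // => i _.
by rewrite ler_wpM2r ?exprn_ge0 // lerXn2r // nnegrE // (le_trans _ (dc i)).
Qed.

(** Pythagoras: the columns of [Y] are orthogonal, with squared norms [d]. *)
Lemma sqnorm_gram_diag m n (Y : 'M[C]_(m, n)) (d : 'rV[C]_n) (u : 'cV[C]_n) :
  Y^t* *m Y = diag_mx d -> sqnorm (Y *m u) = \sum_i d 0 i * `|u i 0| ^+ 2.
Proof.
move=> YY; rewrite sqnormM YY mul_mx_diag mxE; apply: eq_bigr => i _.
by rewrite !mxE normCK; ring.
Qed.

Lemma sqnorm_col_gram_diag m n (Y : 'M[C]_(m, n)) (d : 'rV[C]_n) i :
  Y^t* *m Y = diag_mx d -> sqnorm (col i Y) = d 0 i.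
Proof.
move=> YY; have -> : d 0 i = diag_mx d i i by rewrite mxE eqxx.
rewrite -YY sqnormE mxE; apply: eq_bigr => j _.
by rewrite !mxE normCK mulrC.
Qed.

Lemma unitary_adjK n (V : 'M[C]_n) : V \is unitarymx -> V^t* *m V = 1%:M.
Proof. by move=> uV; rewrite -(invmx_unitary uV) mulVmx ?unitarymx_unit. Qed.

Lemma sqnorm_adj_unitary n (V : 'M[C]_n) (v : 'cV[C]_n) :
  V \is unitarymx -> sqnorm (V^t* *m v) = sqnorm v.
Proof. by move=> uV; rewrite sqnorm_isometry // trmxCK; apply/unitarymxP. Qed.

(** Serves to bound rho(A) and rho(B)^-1: unitary changes of basis preserve norms, so only the
    diagonal factor counts. *)
Lemma sqnorm_unitary_diag_le n (Q : 'M[C]_n) (d : 'rV[C]_n) (c : C) (v : 'cV[C]_n) :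
  Q \is unitarymx -> (forall i, `|d 0 i| <= c) ->
  sqnorm (Q^t* *m diag_mx d *m Q *m v) <= c ^+ 2 * sqnorm v.
Proof.
move=> uQ dc; rewrite -!mulmxA sqnorm_adj_unitary //.
rewrite (le_trans (sqnorm_diag_le _ dc)) // sqnorm_isometry //.
exact: unitary_adjK.
Qed.

Lemma exists_mulmx_eq0 m n (X : 'M[C]_(m, n)) : (\rank X < n)%N ->
  exists2 v : 'cV[C]_n, v != 0 & X *m v = 0.
Proof.
move=> rX; have : kermx X^T != 0.
  by rewrite -mxrank_eq0 mxrank_ker mxrank_tr -lt0n subn_gt0.
case/rowV0Pn => u /sub_kermxP uX u0; exists u^T; first by rewrite trmx_eq0.
by apply: trmx_inj; rewrite trmx_mul trmxK uX trmx0.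
Qed.

End SqNorm.

(** * Singular values, low-rank approximation and the condition number *)

Section SingularValues.
Variable R : realType.
Local Notation C := R[i].

Lemma size_singular_values m n (X : 'M[C]_(m, n)) : size (singular_values X) = n.
Proof. by rewrite size_sort size_map size_enum_ord. Qed.

Lemma sigma_ge0 m n (X : 'M[C]_(m, n)) j : 0 <= sigma X j.
Proof.
rewrite /sigma; have [jn|jn] := ltnP j.-1 (size (singular_values X)); last first.
  by rewrite nth_default.
have := mem_nth 0 jn; rewrite mem_sort => /mapP[i _ ->]; exact: sqrtr_ge0.
Qed.

Lemma sigma_nonincreasing m n (X : 'M[C]_(m, n)) i j :
  (i <= j)%N -> (j < n)%N -> sigma X j.+1 <= sigma X i.+1.
Proof.
move=> ij jn; rewrite /sigma /=.
have sorted_sv : sorted (fun x y : R => y <= x) (singular_values X).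
  by apply: sort_sorted => x y; apply: le_total.
have ge_tr : transitive (fun x y : R => y <= x).
  by move=> x y z yx xz; apply: le_trans xz yx.
have := sorted_leq_nth ge_tr (@lexx _ R) 0 sorted_sv; apply; rewrite ?inE //.
- by rewrite size_singular_values (leq_ltn_trans ij).
- by rewrite size_singular_values.
Qed.

(** The columns of [V] are right singular vectors. They come from the spectral decomposition of X^*
    X, permuted by [s] because [sigma] is sorted whereas [spectral_diag] need not be. *)
Lemma singular_value_basis m n (X : 'M[C]_(m, n)) : exists V : 'M[C]_n,
  V \is unitarymx /\
  (X *m V)^t* *m (X *m V) = diag_mx (\row_i (sigma X i.+1)%:C ^+ 2).
Proof.
set A := X^t* *m X; set P := spectralmx A; set D := spectral_diag A.
have nA : A \is normalmx by apply/normalmxP; rewrite mul_adj trmxCK.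
have uP : P \is unitarymx := spectral_unitarymx A.
have PAP : P *m A *m P^t* = diag_mx D.
  have /orthomx_spectralP -> := nA.
  rewrite -/P -/D -(invmx_unitary uP) !mulmxA mulmxV ?unitarymx_unit // mul1mx.
  by rewrite -mulmxA mulmxV ?unitarymx_unit // mulmx1.
have XPXP : (X *m P^t*)^t* *m (X *m P^t*) = diag_mx D.
  by rewrite mul_adj trmxCK -PAP !mulmxA.
have D_ge0 i : 0 <= D 0 i.
  by rewrite -(sqnorm_col_gram_diag i XPXP) sqnorm_ge0.
pose f i := Num.sqrt (complex.Re (D 0 i)).
have fE i : (f i)%:C ^+ 2 = D 0 i.
  rewrite /f; have := D_ge0 i; case: (D 0 i) => x y.
  by rewrite lecE /= => /andP[/eqP -> x_ge0]; rewrite -rmorphXn /= sqr_sqrtr.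
have /tuple_permP[s sE] : perm_eq (singular_values X) [tuple f i | i < n].
  by rewrite perm_sort.
have sigmaE (i : 'I_n) : sigma X i.+1 = f (s i).
  by rewrite /sigma /= sE (nth_map i) ?size_enum_ord // nth_ord_enum tnth_mktuple.
have sub (G : 'M[C]_n) i j : (row_perm s P *m G *m (row_perm s P)^t*) i j
    = (P *m G *m P^t*) (s i) (s j).
  rewrite !mxE; apply: eq_bigr => l _; rewrite !mxE; congr (_ * _).
  by apply: eq_bigr => h _; rewrite !mxE.
exists ((row_perm s P)^t*); split.
  rewrite trmxC_unitary; apply/unitarymxP/matrixP => i j.
  have := sub 1%:M i j; rewrite !mulmx1 => ->.
  by rewrite (unitarymxP uP) !mxE (inj_eq perm_inj).
apply/matrixP => i j; rewrite mul_adj trmxCK mulmxA -(mulmxA _ (X^t*)).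
rewrite sub PAP !mxE (inj_eq perm_inj).
by rewrite sigmaE fE.
Qed.

(** Along the right singular vectors, each squared coordinate is weighted by some sigma_i^2 <=
    sigma_1^2. *)
Lemma sqnorm_mulmx_le m n (X : 'M[C]_(m, n)) (v : 'cV[C]_n) :
  sqnorm (X *m v) <= (sigma X 1)%:C ^+ 2 * sqnorm v.
Proof.
have [V [uV XVXV]] := singular_value_basis X.
have -> : X *m v = X *m V *m (V^t* *m v).
  by rewrite -!mulmxA (mulmxA V) (unitarymxP uV) mul1mx.
rewrite (sqnorm_gram_diag _ XVXV) -(sqnorm_adj_unitary v uV) sqnormE mulr_sumr.
apply: ler_sum => i _; rewrite mxE ler_wpM2r ?exprn_ge0 //.
by rewrite lerXn2r ?nnegrE ?ler0c ?lecR ?sigma_ge0 // sigma_nonincreasing.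
Qed.

(* One half of the Eckart-Young theorem: on the first d + 1 right singular
   vectors X expands by at least [sigma X d.+1], and Y has a kernel there. *)
Lemma sigma_le_rank_approx m n (X Y : 'M[C]_(m, n)) d (c : R) :
  (d < n)%N -> (\rank Y <= d)%N -> 0 <= c ->
  (forall v, sqnorm ((X - Y) *m v) <= c%:C ^+ 2 * sqnorm v) ->
  sigma X d.+1 <= c.
Proof.
move=> dn rY c0 XYc; have [V [uV XVXV]] := singular_value_basis X.
pose W := colsub (widen_ord dn) V.
have gramW k (G : 'M[C]_(k, n)) (i j : 'I_d.+1) : ((G *m W)^t* *m (G *m W)) i j
    = ((G *m V)^t* *m (G *m V)) (widen_ord dn i) (widen_ord dn j).
  rewrite !mxE; apply: eq_bigr => l _; rewrite !mxE.
  by congr (Num.conj _ * _); apply: eq_bigr => h _; rewrite !mxE.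
have WW : W^t* *m W = 1%:M.
  apply/matrixP => i j; have := gramW _ 1%:M i j; rewrite !mul1mx => ->.
  by rewrite unitary_adjK // !mxE.
(* [Y *m W] has d + 1 columns and rank at most d, so [Y] kills some [W *m u] with u nonzero; on that
   vector X - Y acts as X. *)
have [u u0 YWu] : exists2 u : 'cV[C]_d.+1, u != 0 & Y *m W *m u = 0.
  by apply: exists_mulmx_eq0; rewrite ltnS (leq_trans (mxrankM_maxl _ _)).
have XWXW : (X *m W)^t* *m (X *m W) = diag_mx (\row_i (sigma X i.+1)%:C ^+ 2).
  by apply/matrixP => i j; rewrite gramW XVXV !mxE.
have := XYc (W *m u); rewrite mulmxBl [Y *m _]mulmxA YWu subr0.
rewrite (sqnorm_isometry _ WW) mulmxA (sqnorm_gram_diag _ XWXW) => le_c.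
have : (sigma X d.+1)%:C ^+ 2 * sqnorm u <= c%:C ^+ 2 * sqnorm u.
  apply: le_trans le_c; rewrite sqnormE mulr_sumr ler_sum // => i _.
  rewrite mxE ler_wpM2r ?exprn_ge0 // lerXn2r ?nnegrE ?ler0c ?sigma_ge0 //.
  by rewrite lecR sigma_nonincreasing // -ltnS.
rewrite ler_pM2r ?sqnorm_gt0 // -!rmorphXn lecR.
by rewrite ler_sqr ?nnegrE ?sigma_ge0.
Qed.

(** If sigma_(j+1) vanished, all columns of [X *m V] from that one on would have norm 0, leaving
    rank at most j. *)
Lemma sigma_gt0 m n (X : 'M[C]_(m, n)) j : (j < \rank X)%N -> 0 < sigma X j.+1.
Proof.
move=> jr; rewrite lt_def sigma_ge0 andbT; apply/eqP => sj0.
have jn : (j < n)%N by rewrite (leq_trans jr) ?rank_leq_col.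
have [V [uV XVXV]] := singular_value_basis X.
(* Multiplying by [pid_mx j] on the right keeps the first j columns and zeroes the others. *)
have XVE : X *m V = X *m V *m pid_mx j.
  apply/matrixP => i l; rewrite [RHS]mxE (bigD1 l) //= big1 => [|h hl]; last first.
    by rewrite [pid_mx _ _ _]mxE (inj_eq val_inj) (negPf hl) mulr0.
  rewrite [pid_mx _ _ _]mxE eqxx /= addr0; have [lj|jl] := ltnP; first by rewrite mulr1.
  rewrite mulr0; have /eqP := sqnorm_col_gram_diag l XVXV.
  have sl0 : sigma X l.+1 = 0.
    by apply/eqP; rewrite eq_le sigma_ge0 andbT -sj0 sigma_nonincreasing.
  rewrite mxE sl0 rmorph0 expr0n /= sqnorm_eq0 => /eqP /matrixP /(_ i 0).
  by rewrite !mxE.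
suff : (\rank X <= j)%N by rewrite leqNgt jr.
rewrite -(mxrankMfree X (B := V)) ?row_free_unit ?unitarymx_unit // XVE.
by rewrite (leq_trans (mxrankM_maxr _ _)) // rank_pid_mx // ltnW.
Qed.

Lemma sqnorm_l2norm n (v : 'cV[C]_n) : sqnorm v = (l2norm v)%:C ^+ 2.
Proof.
rewrite -rmorphXn /= sqr_sqrtr ?sumr_ge0 // => [|i _]; last exact: sqr_ge0.
rewrite sqnormE rmorph_sum; apply: eq_bigr => i _.
by rewrite rmorphXn.
Qed.

Lemma l2norm_ge0 n (v : 'cV[C]_n) : 0 <= l2norm v.
Proof. exact: sqrtr_ge0. Qed.

Lemma l2norm_eq n (v : 'cV[C]_n) (c : R) :
  0 <= c -> sqnorm v = c%:C ^+ 2 -> l2norm v = c.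
Proof.
move=> c0; rewrite sqnorm_l2norm -!rmorphXn => -[/eqP].
by rewrite eqrXn2 ?l2norm_ge0 // => /eqP.
Qed.

Lemma l2normZ n (a : R) (v : 'cV[C]_n) : 0 <= a -> l2norm (a%:C *: v) = a * l2norm v.
Proof.
move=> a0; apply: l2norm_eq; first by rewrite mulr_ge0 ?l2norm_ge0.
rewrite rmorphM exprMn -sqnorm_l2norm !sqnormE mulr_sumr; apply: eq_bigr => i _.
by rewrite mxE normrM ger0_norm ?ler0c // exprMn.
Qed.

Lemma l2norm_mulmx_le m n (X : 'M[C]_(m, n)) (v : 'cV[C]_n) :
  l2norm (X *m v) <= sigma X 1 * l2norm v.
Proof.
rewrite -ler_sqr ?nnegrE ?mulr_ge0 ?l2norm_ge0 ?sigma_ge0 //.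
by rewrite -lecR !rmorphXn rmorphM exprMn -!sqnorm_l2norm sqnorm_mulmx_le.
Qed.

Lemma l2norm_le_spectral_norm m n (X : 'M[C]_(m, n)) (v : 'cV[C]_n) :
  l2norm (X *m v) <= spectral_norm X * l2norm v.
Proof.
have [v0|v_neq0] := eqVneq (l2norm v) 0.
  by rewrite v0 mulr0; have := l2norm_mulmx_le X v; rewrite v0 mulr0.
have v_gt0 : 0 < l2norm v by rewrite lt_def v_neq0 l2norm_ge0.
rewrite -ler_pdivrMr // mulrC -l2normZ ?invr_ge0 ?l2norm_ge0 // scalemxAr.
apply: ub_le_sup; last first.
  exists ((l2norm v)^-1%:C *: v) => //=.
  by rewrite l2normZ ?invr_ge0 ?l2norm_ge0 // mulVf.
(* The set is bounded above; otherwise [sup] would take its default value and bound nothing. *)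
exists (sigma X 1) => _ [w /= w1 <-].
by rewrite (le_trans (l2norm_mulmx_le X w)) // ler_piMr ?sigma_ge0.
Qed.

(** Each factor is tested on one vector: X stretches the first right singular vector by sigma_1, and
    the pseudoinverse sends X v, of length sigma_(j+1), back to the unit singular vector v. The
    index j is any one below the rank, since nu * l may be smaller than r - 1. *)
Lemma cond2_ge m n (X : 'M[C]_(m, n)) j : (j < \rank X)%N ->
  sigma X 1 / sigma X j.+1 <= cond2 X.
Proof.
move=> jr; have sj := sigma_gt0 jr.
have jn : (j < n)%N by rewrite (leq_trans jr) ?rank_leq_col.
have [V [uV XVXV]] := singular_value_basis X.
have colM a b c (G : 'M[C]_(a, b)) (H : 'M[C]_(b, c)) i : col i (G *m H) = G *m col i H.
  by rewrite !colE mulmxA.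
have normXV (i : 'I_n) : l2norm (X *m col i V) = sigma X i.+1.
  apply: l2norm_eq; first exact: sigma_ge0.
  by rewrite -colM (sqnorm_col_gram_diag i XVXV) mxE.
have normV (i : 'I_n) : l2norm (col i V) = 1.
  apply: l2norm_eq => //.
  have := unitary_adjK uV; rewrite -diag_const_mx => VV.
  by rewrite (sqnorm_col_gram_diag i VV) mxE rmorph1 expr1n.
have [XYX _ _ adjYX] := moore_penrose_pinv X.
set Y := pinv X in XYX adjYX *.
rewrite /cond2 ler_pM ?invr_ge0 ?sigma_ge0 //.
  have := l2norm_le_spectral_norm X (col (Ordinal (leq_ltn_trans (leq0n j) jn)) V).
  by rewrite normXV normV mulr1.
rewrite -[_^-1]mul1r ler_pdivrMr // -[sigma X j.+1](normXV (Ordinal jn)).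
apply: le_trans (l2norm_le_spectral_norm _ _).
(* Y X is the orthogonal projection onto the range of X^*, which contains the
   right singular vectors of nonzero singular value *)
suff -> : Y *m (X *m col (Ordinal jn) V) = col (Ordinal jn) V by rewrite normV.
have YXX : Y *m X *m X^t* = X^t*.
  by rewrite -[in LHS]adjYX -mul_adj mulmxA XYX.
have XXV : X^t* *m (X *m col (Ordinal jn) V) =
    (sigma X j.+1)%:C ^+ 2 *: col (Ordinal jn) V.
  rewrite mulmxA -[X^t* *m X](mul1mx) -(unitarymxP uV).
  have -> : V *m V^t* *m (X^t* *m X) *m col (Ordinal jn) V =
      V *m col (Ordinal jn) ((X *m V)^t* *m (X *m V)).
    by rewrite mul_adj !colM !mulmxA.
  rewrite XVXV -colM mul_mx_diag; apply/matrixP => i l.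
  by rewrite !mxE mulrC.
have s2 : (sigma X j.+1)%:C ^+ 2 != 0.
  by rewrite expf_neq0 // (inj_eq (@complexI R) _ 0) gt_eqF.
by apply: (scalerI s2); rewrite mulmxA scalemxAr -XXV mulmxA YXX.
Qed.

End SingularValues.

(** * Rational functions of normal matrices *)

Lemma normalmx_diag (C : numClosedFieldType) n (A : 'M[C]_n) : A \is normalmx ->
  exists (P : 'M[C]_n) (a : 'rV[C]_n),
    [/\ P \is unitarymx, A = P^t* *m diag_mx a *m P & forall i, eigenvalue A (a 0 i)].
Proof.
move=> nA; exists (spectralmx A), (spectral_diag A).
have uP := spectral_unitarymx A.
have AE : A = (spectralmx A)^t* *m diag_mx (spectral_diag A) *m spectralmx A.
  by rewrite -(invmx_unitary uP); apply/orthomx_spectralP.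
(* [eigenvalue] refers to row vectors, and the rows of [spectralmx A] are left eigenvectors. *)
split=> // i; apply/eigenvalueP; exists (row i (spectralmx A)).
  rewrite [X in _ *m X]AE !mulmxA -row_mul (unitarymxP uP) row1 -rowE.
  by rewrite row_diag_mx -scalemxAl -rowE.
rewrite rowE mulmx_free_eq0 ?row_free_unit ?unitarymx_unit //.
by apply/eqP => /matrixP /(_ 0 i) /eqP; rewrite !mxE !eqxx oner_eq0.
Qed.

Section Zolotarev.
Variable R : realType.
Local Notation C := R[i].

(** With rho = p / q, the matrices [G] and [H] are rho(A) and rho(B)^-1. Bounding q / p from above
    on the spectrum of [B], rather than p / q from below, allows poles of rho there: q / p is then
    0. *)
Lemma sigma_le_rational m n k (A : 'M[C]_m) (B : 'M[C]_n) (X : 'M[C]_(m, n))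
    (p q : {poly C}) (alpha beta : R) :
  A \is normalmx -> B \is normalmx ->
  (size p <= k.+1)%N -> (size q <= k.+1)%N -> 0 <= alpha -> 0 <= beta ->
  (forall z, eigenvalue A z -> q.[z] != 0 /\ `|p.[z] / q.[z]| <= alpha%:C) ->
  (forall z, eigenvalue B z -> p.[z] != 0 /\ `|q.[z] / p.[z]| <= beta%:C) ->
  (k * \rank (A *m X - X *m B)%R < n)%N ->
  sigma X (k * \rank (A *m X - X *m B)%R).+1 <= alpha * beta * sigma X 1.
Proof.
move=> nA nB sp sq a_ge0 b_ge0 hA hB kn.
have [P [a [uP AE eigA]]] := normalmx_diag nA.
have [Q [b [uQ BE eigB]]] := normalmx_diag nB.
pose g := \row_i (p.[a 0 i] / q.[a 0 i]); pose h := \row_j (q.[b 0 j] / p.[b 0 j]).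
pose G := P^t* *m diag_mx g *m P; pose H := Q^t* *m diag_mx h *m Q.
pose X' := P *m X *m Q^t*.
have XE : X = P^t* *m X' *m Q.
  rewrite /X' !mulmxA unitary_adjK // mul1mx -mulmxA unitary_adjK //.
  by rewrite mulmx1.
have commE : diag_mx a *m X' - X' *m diag_mx b = P *m (A *m X - X *m B) *m Q^t*.
  have PA : P *m A = diag_mx a *m P by rewrite AE !mulmxA (unitarymxP uP) mul1mx.
  have BQ : B *m Q^t* = Q^t* *m diag_mx b.
    by rewrite BE -!mulmxA (unitarymxP uQ) mulmx1.
  by rewrite mulmxBr mulmxBl !mulmxA PA -!mulmxA BQ.
have rank_comm : \rank (diag_mx a *m X' - X' *m diag_mx b) = \rank (A *m X - X *m B).
  rewrite commE mxrankMfree ?row_free_unit ?unitarymx_unit ?trmxC_unitary //.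
  rewrite -mxrank_tr trmx_mul mxrankMfree ?mxrank_tr //.
  by rewrite row_free_unit unitmx_tr unitarymx_unit.
have GXH : G *m X *m H = P^t* *m (diag_mx g *m X' *m diag_mx h) *m Q.
  by rewrite /G /H /X' !mulmxA.
have leG w : sqnorm (G *m w) <= alpha%:C ^+ 2 * sqnorm w.
  apply: sqnorm_unitary_diag_le => // i.
  by rewrite mxE; have [_] := hA _ (eigA i); apply.
have leH w : sqnorm (H *m w) <= beta%:C ^+ 2 * sqnorm w.
  apply: sqnorm_unitary_diag_le => // j.
  by rewrite mxE; have [_] := hB _ (eigB j); apply.
clearbody G H X'.
(* The low-rank approximant is X - G X H, and the error G X H has norm at most alpha beta
   sigma_1. *)
apply: (sigma_le_rank_approx (Y := X - G *m X *m H)) => //.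
- have -> : X - G *m X *m H = P^t* *m (X' - diag_mx g *m X' *m diag_mx h) *m Q.
    by rewrite mulmxBr mulmxBl -XE -GXH.
  (* Entry (i, j) is X'_ij (1 - rho(a_i) / rho(b_j)). Its denominator q(a_i) p(b_j) splits into a
     row and a column scaling, and the row scaling absorbs the sign. *)
  have -> : X' - diag_mx g *m X' *m diag_mx h =
      diag_mx (\row_i (- q.[a 0 i]^-1)) *m
      (\matrix_(i, j) (X' i j * (p.[a 0 i] * q.[b 0 j] - q.[a 0 i] * p.[b 0 j]))) *m
      diag_mx (\row_j p.[b 0 j]^-1).
    apply/matrixP => i j; rewrite !mul_mx_diag !mul_diag_mx !(mxE, mul_diag_mx).
    have [qa _] := hA _ (eigA i); have [pb _] := hB _ (eigB j).
    by field; rewrite qa pb.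
  rewrite (leq_trans (mxrankM_maxl _ _)) // (leq_trans (mxrankM_maxr _ _)) //.
  rewrite (leq_trans (mxrankM_maxl _ _)) // (leq_trans (mxrankM_maxr _ _)) //.
  by rewrite -rank_comm rank_divided_difference.
- by rewrite !mulr_ge0 ?sigma_ge0.
move=> v; rewrite opprB addrC subrK -!mulmxA.
have -> : (alpha * beta * sigma X 1)%:C ^+ 2 * sqnorm v
    = alpha%:C ^+ 2 * ((sigma X 1)%:C ^+ 2 * (beta%:C ^+ 2 * sqnorm v)).
  by rewrite !rmorphM /=; ring.
rewrite (le_trans (leG _)) // ler_wpM2l ?exprn_ge0 ?ler0c //.
rewrite (le_trans (sqnorm_mulmx_le _ _)) //.
by rewrite ler_wpM2l ?exprn_ge0 ?ler0c ?sigma_ge0.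
Qed.

(** * Lower bounds for the Zolotarev number *)

(** Moves from [\bar R] to real bounds: alpha is sup_E |rho| and beta is 1 / inf_F |rho|. When one
    of these is infinite, the exclusion of indeterminate forms makes the quotient +oo and the bound
    trivial. *)
Lemma zolotarev_ge k (E F : set C) (c : R) : E !=set0 -> F !=set0 -> 0 < c ->
  (forall (p q : {poly C}) (alpha beta : R),
     (size p <= k.+1)%N -> (size q <= k.+1)%N -> 0 <= alpha -> 0 <= beta ->
     (forall z, E z -> q.[z] != 0 /\ `|p.[z] / q.[z]| <= alpha%:C) ->
     (forall z, F z -> p.[z] != 0 /\ `|q.[z] / p.[z]| <= beta%:C) ->
     c <= alpha * beta) ->
  (c%:E <= zolotarev k E F)%E.
Proof.
move=> [z0 Ez0] [w0 Fw0] c0 hc.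
apply/ereal_infP => _ [[p q] [[/= cop q0 sp sq] indet] <-].
have abs_ge0 r z : (0 <= @ratabs R r z)%E.
  rewrite /ratabs; case: ifP => _ //; rewrite lee_fin.
  by case: (_ / _) => x y; apply: sqrtr_ge0.
have supE z : E z -> (ratabs (p, q) z <= ratsup E (p, q))%E.
  by move=> Ez; apply: ereal_sup_ubound; exists z.
have infF z : F z -> (ratinf F (p, q) <= ratabs (p, q) z)%E.
  by move=> Fz; apply: ereal_inf_lbound; exists z.
have sup_ge0 : (0 <= ratsup E (p, q))%E by apply: le_trans (supE _ Ez0).
have inf_ge0 : (0 <= ratinf F (p, q))%E.
  by apply/ereal_infP => _ [z _ <-].
(* If the supremum is +oo, the infimum is not, so its inverse is positive and the quotient is
   +oo. *)
case: (ratsup E (p, q)) sup_ge0 supE indet => [alpha|_ _|//]; last first.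
  move=> ni; rewrite gt0_mulye ?leey // lt0e inve_ge0 // inf_ge0 andbT.
  apply/eqP => /(congr1 inve); rewrite inveK inve0 => e; apply: ni; by right.
rewrite lee_fin => a_ge0 supE ni.
(* If the infimum is 0, the supremum alpha is positive and the quotient is again +oo. *)
have [inf0|inf_neq0] := eqVneq (ratinf F (p, q)) 0%E.
  rewrite inf0 inve0 gt0_muley ?leey // lte_fin lt_def a_ge0 andbT.
  by apply/eqP => a0; apply: ni; left; rewrite inf0 a0.
(* If |rho| is infinite on all of F, the infimum is +oo and beta = 0. *)
pose beta := fine ((ratinf F (p, q))^-1)%E.
have betaE : ((ratinf F (p, q))^-1)%E = beta%:E.
  rewrite /beta; case: (ratinf F (p, q)) inf_ge0 inf_neq0 => [b|//|//] _ /=.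
  by rewrite eqe inver => /negPf ->.
rewrite betaE -EFinM lee_fin; apply: (hc p q) => //.
- by rewrite -lee_fin -betaE inve_ge0.
- move=> z Ez; have := supE z Ez; rewrite /ratabs /=.
  by case: ifPn => // qz; rewrite lee_fin -lecR.
move=> z Fz; have := infF z Fz; rewrite /ratabs /=; case: ifPn => [qz _|qz le_b].
  (* At a pole in F, coprimality gives p(z) != 0, and q / p vanishes. *)
  split; last by rewrite (rootP qz) mul0r normr0 ler0c -lee_fin -betaE inve_ge0.
  by apply: coprimep_root qz; rewrite coprimep_sym.
case: (ratinf F (p, q)) inf_ge0 inf_neq0 betaE le_b => [b|//|//].
rewrite lee_fin eqe inver => b_ge0 b_neq0; rewrite (negPf b_neq0) lee_fin => -[<-].
have b_gt0 : 0 < b by rewrite lt_def b_neq0.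
rewrite -lecR => le_b.
have norm_gt0 : 0 < `|p.[z] / q.[z]| by apply: lt_le_trans le_b; rewrite ltcR.
have [pz _] : p.[z] != 0 /\ q.[z]^-1 != 0.
  by move: norm_gt0; rewrite normr_gt0 mulf_eq0 negb_or => /andP.
split=> //; rewrite -[q.[z] / _]invrK invf_div normfV fmorphV.
by rewrite lef_pV2 // posrE ltcR.
Qed.

End Zolotarev.

(** * The two lower bounds on ratios of singular values *)

Theorem theorem2 (R : realType) (m n nu r : nat)
    (A : 'M[R[i]]_m) (B : 'M[R[i]]_n) (E F : set R[i])
    (X : 'M[R[i]]_(m, n)) (M : 'M[R[i]]_(m, nu)) (N : 'M[R[i]]_(n, nu))
    (hmn : (n <= m)%N)
    (hA : A \is normalmx) (hB : B \is normalmx)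
    (hE : [set z | eigenvalue A z] `<=` E)
    (hF : [set z | eigenvalue B z] `<=` F)
    (hrank : \rank X = r) (hr : (1 <= r)%N)
    (hnu : (1 <= nu <= n)%N)
    (hX : A *m X - X *m B = M *m N^t*) :
  (forall k : nat, (k%:R <= (n%:R - 1) / nu%:R :> R) ->
     ((sigma X 1)%:E / (sigma X (1 + nu * k))%:E >= (zolotarev k E F)^-1)%E)
  /\
  ((cond2 X)%:E >= (zolotarev ((r - 1) %/ nu) E F)^-1)%E.
Proof.
have [nu_gt0 _] := andP hnu.
have n_gt0 : (0 < n)%N by rewrite (leq_trans hr) // -hrank rank_leq_col.
have m_gt0 : (0 < m)%N by rewrite (leq_trans n_gt0).
have s1_gt0 : 0 < sigma X 1 by apply: sigma_gt0; rewrite hrank.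
have E_neq0 : E !=set0 by have [z eigz] := eigenvalue_closed A m_gt0; exists z; apply: hE.
have F_neq0 : F !=set0 by have [z eigz] := eigenvalue_closed B n_gt0; exists z; apply: hF.
(* Common to both claims: with sigma_(1 + nu k) positive, inverting both sides turns the claim into
   a real lower bound on the Zolotarev number. *)
have main k : (nu * k < n)%N -> 0 < sigma X (1 + nu * k) ->
    ((zolotarev k E F)^-1 <= (sigma X 1 / sigma X (1 + nu * k))%:E)%E.
  move=> kn sk_gt0.
  have div_gt0 : 0 < sigma X (1 + nu * k) / sigma X 1 by rewrite divr_gt0.
  have -> : (sigma X 1 / sigma X (1 + nu * k))%:E
      = ((sigma X (1 + nu * k) / sigma X 1)%:E^-1)%E.
    by rewrite inver gt_eqF // invf_div.
  suff le_zol : ((sigma X (1 + nu * k) / sigma X 1)%:E <= zolotarev k E F)%E.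
    by rewrite lee_pV2 // inE ?(le_trans _ le_zol) // lee_fin ltW.
  apply: zolotarev_ge => // p q alpha beta sp sq a_ge0 b_ge0 qE pF.
  rewrite ler_pdivrMr //.
  have rank_comm : (\rank (A *m X - X *m B)%R <= nu)%N.
    by rewrite hX (leq_trans (mxrankM_maxl _ _)) ?rank_leq_col.
  (* The commutator may have rank below nu; [sigma_le_rational] then bounds a singular value of
     smaller index, which dominates sigma_(1 + nu k). *)
  have le_k : (k * \rank (A *m X - X *m B)%R <= nu * k)%N.
    by rewrite mulnC leq_mul2r rank_comm orbT.
  apply: le_trans (sigma_nonincreasing _ le_k kn) _.
  apply: (sigma_le_rational (p := p) (q := q)) => //.
  - by move=> z /hE; apply: qE.
  - by move=> z /hF; apply: pF.
  - exact: leq_ltn_trans kn.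
split=> [k|].
  rewrite ler_pdivlMr ?ltr0n // lerBrDr -natrM natr1 ler_nat mulnC => kn.
  (* For a zero denominator, [0^-1 = +oo] and sigma_1 > 0 make the left side +oo, as the convention
     asks. *)
  have [sk0|sk_neq0] := eqVneq (sigma X (1 + nu * k)) 0.
    by rewrite sk0 inve0 gt0_muley ?leey.
  by rewrite inver (negPf sk_neq0) -EFinM main // lt_def sk_neq0 sigma_ge0.
set k := ((r - 1) %/ nu)%N.
(* Since nu k <= r - 1, the index 1 + nu k is at most the rank, so that singular value is
   nonzero. *)
have kr : (nu * k < r)%N.
  by rewrite mulnC (leq_ltn_trans (leq_trunc_div _ _)) // subn1 prednK.
have sk_gt0 : 0 < sigma X (1 + nu * k) by apply: sigma_gt0; rewrite hrank.
apply: (le_trans (main k _ sk_gt0)).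
  by rewrite (leq_trans kr) // -hrank rank_leq_col.
by rewrite lee_fin cond2_ge // hrank.
Qed.
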